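(* Let $(M^{2n},\theta,\mu)$ be a $(2n,k)$-manifold with $\mu(M^{2n})=P^k$. Then the space $\mathfrak{E}(M^{2n},P^k)$ is homeomorphic to $M^{2n}$; a homeomorphism is given by the map $G_2:\mathfrak{E}(M^{2n},P^k)\to M^{2n}$, $G_2(x,y)=y$.
   Context: Conventions. $T^k=(S^1)^k$; $\mathring{P}$ is the relative interior of a convex polytope $P$ (a point is its own relative interior); for a subset $Y$ of a topological space, $\bar\partial Y=\overline{Y}\setminus Y$; $[1,m]=\{1,\dots,m\}$. A $(2n,k)$-manifold ($1\le k\le n$) is a triple $(M^{2n},\theta,\mu)$: $M^{2n}$ is a smooth closed oriented $2n$-manifold; $\theta$ is a smooth effective action of $T^k$ on $M^{2n}$ all of whose stabilizers are connected; $\mu:M^{2n}\to\mathbb{R}^k$ (the almost moment map) is a smooth $T^k$-invariant map whose image is a $k$-dimensional convex polytope $P^k$ and which is open as a map onto $P^k$; and Axioms 1-6 hold. Axiom 1. There is a smooth atlas $\{(M_i,\varphi_i)\}$ of $M^{2n}$ with $M_i$ open, $T^k$-invariant and dense, $\varphi_i:M_i\to\mathbb{R}^{2n}$ coordinate homeomorphisms, each $M_i$ containing exactly one $T^k$-fixed point $x_i$, with $\varphi_i(x_i)=0$ and $x_i\ne x_j$ for $i\neq j$. (The atlas is finite, indexed by $[1,m]$, $m$ being the number of fixed points.) Put $Y_i=M^{2n}\setminus M_i$, and for $\sigma\subseteq[1,m]$ put $W_\sigma=\bigcap_{i\in\sigma}M_i\cap\bigcap_{i\notin\sigma}Y_i$.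 If $W_\sigma\ne\emptyset$, it is called a stratum and $\sigma$ is called admissible; $\mathfrak{S}$ is the set of admissible sets. The strata are $T^k$-invariant and partition $M^{2n}$. The main stratum is $W=W_{[1,m]}$. Axiom 2. $\mu$ gives a bijection between the fixed points and the vertices of $P^k$. Put $v_i=\mu(x_i)$; for $\sigma\in\mathfrak{S}$ the admissible polytope is $P_\sigma=\mathrm{conv}\{v_i:i\in\sigma\}$. Axiom 3. The stabilizer is constant on each stratum. Let $T^\sigma$ be the quotient of $T^k$ by the stabilizer of points of $W_\sigma$; it acts freely on $W_\sigma$ and $W_\sigma/T^\sigma=W_\sigma/T^k$. Axiom 4. Let $\widehat\mu:M^{2n}/T^k\to P^k$ be induced by $\mu$. For $\sigma\in\mathfrak{S}$: (a) $\mu(W_\sigma)=\mathring{P_\sigma}$; (b) the restriction $\widehat\mu_\sigma:W_\sigma/T^\sigma\to\mathring{P_\sigma}$ is a fiber bundle; (c) $\dim P_\sigma=\dim T^\sigma$. This bundle is trivial (contractible base); its fiber $F_\sigma$ is the space of parameters of $W_\sigma$, and $F$ is that of the main stratum. A trivialization $h_\sigma:W_\sigma/T^\sigma\to\mathring{P_\sigma}\times F_\sigma$ over $\mathring{P_\sigma}$ is fixed as part of the structure; $\xi_\sigma:W_\sigma/T^\sigma\to F_\sigma$ is its second component. For $c\in F_\sigma$ the leaf $W_\sigma[\xi_\sigma,c]\subset W_\sigma$ is the preimage of $\xi_\sigma^{-1}(c)$ under $W_\sigma\to W_\sigma/T^\sigma$. Axiom 5. For every leaf $W_\sigma[\xi_\sigma,c_\sigma]$: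 (a) it is a smooth submanifold of $M^{2n}$ and $\mu$ restricts to a smooth fiber bundle $W_\sigma[\xi_\sigma,c_\sigma]\to\mathring{P_\sigma}$; (b) $\bar\partial W_\sigma[\xi_\sigma,c_\sigma]$ is the union of leaves $W_{\bar\sigma}[\xi_{\bar\sigma},c_{\bar\sigma}]$, for exactly one $c_{\bar\sigma}\in F_{\bar\sigma}$ for each $\bar\sigma$, where $P_{\bar\sigma}$ runs through some admissible faces of $P_\sigma$; (c) the map $\eta_{\sigma,\bar\sigma}:F_\sigma\to F_{\bar\sigma}$, $c_\sigma\mapsto c_{\bar\sigma}$, given by (b) is continuous. Complexes. $C(M^{2n},P^k)=\bigsqcup_{\sigma\in\mathfrak{S}}P'_\sigma$ is a formal disjoint union of copies $P'_\sigma$ of $\mathring{P_\sigma}$; $\widehat\pi:C(M^{2n},P^k)\to P^k$ is the canonical map, identifying each $P'_\sigma$ with $\mathring{P_\sigma}$. The map $f:M^{2n}\to C(M^{2n},P^k)$ sends $y\in W_\sigma$ to the unique $x\in P'_\sigma$ with $\widehat\pi(x)=\mu(y)$. $CQ(M^{2n},P^k)$ is $C(M^{2n},P^k)$ with the quotient topology of $f$. The space $\mathfrak{E}(M^{2n},P^k)=\{(x,y)\in C(M^{2n},P^k)\times M^{2n}: x\in P'_\sigma,\ y\in W_\sigma\text{ for some }\sigma\in\mathfrak{S},\ \widehat\pi(x)=\mu(y)\}$ has the topology induced from $CQ(M^{2n},P^k)\times M^{2n}$; $T^k$ acts on it through the second factor. Points of $\mathfrak{E}(M^{2n},P^k)/T^k$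 are written as pairs $(x,c)$, $x\in P'_\sigma$, $c\in F_\sigma$, via $h_\sigma$. Axiom 6. There are a topological space $\mathcal{F}$ and, for each $\sigma\in\mathfrak{S}$, a topological space $\tilde F_\sigma$ and a continuous inclusion $I_\sigma:\tilde F_\sigma\to\mathcal{F}$ (write $\tilde F,I$ for $\sigma=[1,m]$ and $\tilde F_i,I_i$ for $\sigma=\{i\}$) such that: (a) $\tilde F=F$ and $\mathcal{F}$ is a compactification of $I(F)$; (b) $I_\sigma(\tilde F_\sigma)\subset I_{\bar\sigma}(\tilde F_{\bar\sigma})$ whenever $P_{\bar\sigma}$ is an admissible face of $P_\sigma$, and $\mathcal{F}=\bigcup_{i=1}^m I_i(\tilde F_i)$; (c) there are continuous projections $p_\sigma:\tilde F_\sigma\to F_\sigma$ with $p_{\bar\sigma}\circ\tilde\eta_{\sigma,\bar\sigma}=\eta_{\sigma,\bar\sigma}\circ p_\sigma$, where $\tilde\eta_{\sigma,\bar\sigma}:\tilde F_\sigma\to\tilde F_{\bar\sigma}$ is the inclusion given by (b); (d) the map $H:\mathcal{E}=\bigcup_\sigma P'_\sigma\times\tilde F_\sigma\to\mathfrak{E}(M^{2n},P^k)/T^k$, $H(x,\tilde c)=(x,p_\sigma(\tilde c))$, is continuous, where $\mathcal{E}$ has the topology induced by the embedding $\mathcal{E}\to CQ(M^{2n},P^k)\times\mathcal{F}$, $(x,\tilde c)\mapsto(x,I_\sigma(\tilde c))$. *)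

(* Defs.v *)
From HB Require Import structures.
From mathcomp Require Import all_boot all_order all_algebra.
From mathcomp Require Import all_classical all_reals all_analysis.

Set Implicit Arguments.
Unset Strict Implicit.
Unset Printing Implicit Defensive.

Import Order.TTheory GRing.Theory Num.Theory numFieldNormedType.Exports.

Local Open Scope classical_set_scope.
Local Open Scope ring_scope.

Definition homeomorphism (X Y : topologicalType) (f : X -> Y) : Prop :=
  continuous f /\
  exists g : Y -> X, [/\ continuous g, cancel f g & cancel g f].

Definition final_topology {X Y : Type} (f : X -> Y) : Type := Y.

Section FinalTopology.
Variables (X : topologicalType) (Y : choiceType) (f : X -> Y).
Local Notation Z := (final_topology f).

Definition final_open (U : set Z) : Prop := open (f @^-1` U).

Lemma final_openT : final_open setT.
Proof. by rewrite /final_open preimage_setT; exact: openT. Qed.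

Lemma final_openI : setI_closed final_open.
Proof. by move=> U V oU oV; rewrite /final_open preimage_setI; exact: openI. Qed.

Lemma final_open_bigU (I : Type) (g : I -> set Z) :
  (forall i, final_open (g i)) -> final_open (\bigcup_i g i).
Proof.
move=> og; rewrite /final_open preimage_bigcup.
by apply: bigcup_open => i _; exact: og.
Qed.

HB.instance Definition _ := Choice.on Z.
HB.instance Definition _ :=
  isOpenTopological.Build Z final_openT final_openI final_open_bigU.
End FinalTopology.

Definition fiber_bundle (E B F : topologicalType) (p : E -> B) : Prop :=
  [/\ continuous p,
      range p = setT
    & forall b : B, exists U : set B,
        [/\ open U, U b
          & exists2 phi : set_type (p @^-1` U) -> (set_type U * F)%type,
              homeomorphism phi
              & forall e, set_val (phi e).1 = p (set_val e)]].

Section Convex.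
Variables (R : realType) (k : nat).
Implicit Types (A P Q : set 'rV[R]_k).

Definition aff_hull A : set 'rV[R]_k :=
  [set x | exists (N : nat) (p : 'I_N -> 'rV[R]_k) (w : 'I_N -> R),
    [/\ forall i, A (p i), \sum_i w i = 1 & x = \sum_i w i *: p i]].

Definition conv_hull A : set 'rV[R]_k :=
  [set x | exists (N : nat) (p : 'I_N -> 'rV[R]_k) (w : 'I_N -> R),
    [/\ forall i, A (p i), forall i, 0 <= w i, \sum_i w i = 1
      & x = \sum_i w i *: p i]].

Definition lin_dim (V : set 'rV[R]_k) (d : nat) : Prop :=
  exists2 B : 'M[R]_(d, k), row_free B & V = [set v | (v <= B)%MS].

(* The dimension of a convex set is that of its affine hull. *)
Definition aff_dim A (d : nat) : Prop :=
  exists2 x0, A x0 & lin_dim [set x - x0 | x in aff_hull A] d.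

Definition relint A : set 'rV[R]_k :=
  [set x | A x /\ exists2 U, nbhs x U & U `&` aff_hull A `<=` A].

Definition polytope P : Prop :=
  exists2 A, finite_set A & P = conv_hull A.

(* Faces are cut out by supporting hyperplanes; for u = 0 and c = 0 this is P
   itself. *)
Definition face_of Q P : Prop :=
  exists (u : 'rV[R]_k) (c : R),
    (forall x, P x -> \sum_j u 0 j * x 0 j <= c) /\
    Q = P `&` [set x | \sum_j u 0 j * x 0 j = c].

Definition vertices P : set 'rV[R]_k := [set v | face_of [set v] P].

End Convex.

(* f is of class C^r on the open set [U]: iterated partial derivatives of
   order at most r exist and are continuous on U. *)
Fixpoint Cr (R : realType) (a b r : nat)
    (U : set 'rV[R]_a) (f : 'rV[R]_a -> 'rV[R]_b) : Prop :=
  (forall x, U x -> {for x, continuous f}) /\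
  match r with
  | 0 => True
  | r'.+1 => forall i : 'I_a,
      (forall x, U x -> derivable f x (delta_mx 0 i)) /\
      Cr r' U ('D_(delta_mx 0 i) f)
  end.

Definition Cinfty (R : realType) (a b : nat)
    (U : set 'rV[R]_a) (f : 'rV[R]_a -> 'rV[R]_b) : Prop :=
  forall r, Cr r U f.

(* [cmap] is meaningful on [cdom] only, and [cinv], the inverse of [cmap], on
   the image of [cdom] only. *)
Record chart (R : realType) (X : topologicalType) (d : nat) := Chart {
  cdom : set X;
  cmap : X -> 'rV[R]_d;
  cinv : 'rV[R]_d -> X
}.

Section Manifolds.
Variable R : realType.

Section Atlas.
Variables (X : topologicalType) (d : nat).
Implicit Types (c : chart R X d) (A O : set (chart R X d)).

Definition cimg c : set 'rV[R]_d := cmap c @` cdom c.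

Definition is_chart c : Prop :=
  [/\ open (cdom c), open (cimg c),
      {within cdom c, continuous (cmap c)},
      {within cimg c, continuous (cinv c)}
    & forall x, cdom c x -> cinv c (cmap c x) = x].

Definition transition c c' : 'rV[R]_d -> 'rV[R]_d := cmap c' \o cinv c.

Definition overlap c c' : set 'rV[R]_d := cmap c @` (cdom c `&` cdom c').

Definition compatible c c' : Prop :=
  Cinfty (overlap c c') (transition c c') /\
  Cinfty (overlap c' c) (transition c' c).

Definition smooth_atlas A : Prop :=
  [/\ forall c, A c -> is_chart c,
      forall x, exists2 c, A c & cdom c x
    & forall c c', A c -> A c' -> compatible c c'].

Definition max_atlas A : set (chart R X d) :=
  [set c | is_chart c /\ forall c', A c' -> compatible c c'].

Definition smooth_manifold A : Prop :=
  [/\ hausdorff_space X, @second_countable X & smooth_atlas A].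

Definition orientation A O : Prop :=
  [/\ O `<=` max_atlas A, smooth_atlas O
    & forall c c', O c -> O c' -> forall v, overlap c c' v ->
        0 < \det ('J (transition c c') v)].

(* Embedded submanifold of dimension e, by slice charts. *)
Definition smooth_submanifold A (L : set X) : Prop :=
  exists2 e : nat, (e <= d)%N & forall x, L x ->
    exists c, [/\ max_atlas A c, cdom c x
      & cmap c @` (cdom c `&` L) =
        cimg c `&` [set v | forall j : 'I_d, (e <= j)%N -> v 0 j = 0]].

End Atlas.

Definition eucl_atlas (d : nat) : set (chart R 'rV[R]_d d) :=
  [set Chart setT id id].

Definition prod_chart (X Y : topologicalType) (a b : nat)
    (c : chart R X a) (c' : chart R Y b) : chart R (X * Y)%type (a + b) :=
  Chart (cdom c `*` cdom c')
        (fun p => row_mx (cmap c p.1) (cmap c' p.2))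
        (fun v => (cinv c (lsubmx v), cinv c' (rsubmx v))).

Definition prod_atlas (X Y : topologicalType) (a b : nat)
    (A : set (chart R X a)) (B : set (chart R Y b)) :
    set (chart R (X * Y)%type (a + b)) :=
  [set prod_chart c c' | c in A & c' in B].

Section SmoothMaps.
Variables (X Y : topologicalType) (a b : nat).
Variables (A : set (chart R X a)) (B : set (chart R Y b)).

Definition smooth_open (O : set X) (g : X -> Y) : Prop :=
  (forall x, O x -> {for x, continuous g}) /\
  forall c c', A c -> B c' ->
    Cinfty (cmap c @` (cdom c `&` O `&` g @^-1` cdom c'))
           (cmap c' \o g \o cinv c).

(* Smoothness on an arbitrary subset: local smooth extendability. *)
Definition smooth_on (S : set X) (g : X -> Y) : Prop :=
  forall x, S x -> exists O g',
    [/\ open O, O x, smooth_open O g' & {in O `&` S, g =1 g'}].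

End SmoothMaps.

(* [p] restricts to a smooth fiber bundle [L -> S], where [L] is a submanifold
   of [X] and [S] a submanifold of R^k; [phi] and [psi] are mutually inverse
   local trivializations over [U `&` S]. *)
Definition smooth_fiber_bundle (X : topologicalType) (d k : nat)
    (A : set (chart R X d)) (L : set X) (S : set 'rV[R]_k)
    (p : X -> 'rV[R]_k) : Prop :=
  p @` L = S /\
  exists (e : nat) (Z : topologicalType) (AZ : set (chart R Z e)),
    smooth_manifold AZ /\
    forall b, S b -> exists U : set 'rV[R]_k,
      [/\ open U, U b
        & exists (phi : X -> 'rV[R]_k * Z) (psi : 'rV[R]_k * Z -> X),
          let LU := L `&` p @^-1` U in
          let UZ := (U `&` S) `*` [set: Z] in
          [/\ smooth_on A (prod_atlas (@eucl_atlas k) AZ) LU phi,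
              smooth_on (prod_atlas (@eucl_atlas k) AZ) A UZ psi,
              forall x, LU x -> (phi x).1 = p x /\ psi (phi x) = x
            & forall q, UZ q -> LU (psi q) /\ phi (psi q) = q]].

End Manifolds.
Arguments eucl_atlas : clear implicits.

Section Torus.
Variables (R : realType) (k : nat).

(* (S^1)^k inside (R^2)^k = C^k: row j of a matrix is the j-th coordinate
   x + iy, with x in column 0 and y in column 1. *)
Definition torus : set 'M[R]_(k, 2) :=
  [set t | forall j, t j 0 ^+ 2 + t j 1 ^+ 2 = 1].

Definition torus1 : 'M[R]_(k, 2) := \matrix_(j, i) (i == 0)%:R.

Definition torusM (s t : 'M[R]_(k, 2)) : 'M[R]_(k, 2) :=
  \matrix_(j, i) (if i == 0 then s j 0 * t j 0 - s j 1 * t j 1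
                  else s j 0 * t j 1 + s j 1 * t j 0).

(* The exponential map of the Lie group T^k, v |-> (e^(i v_j))_j. *)
Definition torus_exp (v : 'rV[R]_k) : 'M[R]_(k, 2) :=
  \matrix_(j, i) (if i == 0 then cos (v 0 j) else sin (v 0 j)).

(* The dimension of T^k / H for a closed subgroup H is k minus the dimension
   of the Lie algebra {v | exp (s v) \in H for all s} of H. *)
Definition torus_quotient_dim (H : set 'M[R]_(k, 2)) (d : nat) : Prop :=
  exists2 e : nat,
    lin_dim [set v | forall s : R, H (torus_exp (s *: v))] e & (d + e = k)%N.

Section Action.
Variables (X : Type) (act : 'M[R]_(k, 2) -> X -> X).

(* Only the values [act t] with [t] in [torus] matter. *)
Definition torus_action : Prop :=
  (forall x, act torus1 x = x) /\
  (forall s t x, torus s -> torus t -> act (torusM s t) x = act s (act t x)).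

Definition stabilizer (x : X) : set 'M[R]_(k, 2) :=
  torus `&` [set t | act t x = x].

Definition fixed_points : set X := [set x | forall t, torus t -> act t x = x].

Definition orbit (x : X) : set X := [set act t x | t in torus].

Definition invariant_set (S : set X) : Prop :=
  forall t x, torus t -> S x -> S (act t x).

End Action.

(* The torus carries the smooth structure for which the covering [torus_exp]
   is a local diffeomorphism, so that smoothness of T^k x X -> X amounts to
   smoothness of its composite with the covering R^k x X -> T^k x X. *)
Definition smooth_torus_action (X : topologicalType) (d : nat)
    (A : set (chart R X d)) (act : 'M[R]_(k, 2) -> X -> X) : Prop :=
  torus_action act /\
  smooth_open (prod_atlas (eucl_atlas R k) A) A setT
    (fun p : 'rV[R]_k * X => act (torus_exp p.1) p.2).

Section OrbitSpace.
Local Open Scope quotient_scope.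
Variables (X : topologicalType) (act : 'M[R]_(k, 2) -> X -> X) (S : set X).

Definition same_orbit (x y : set_type S) : bool :=
  `[< orbit act (set_val x) = orbit act (set_val y) >].

Lemma same_orbit_equiv : equiv_class_of same_orbit.
Proof.
split=> [x|x y|y x z].
- by apply/asboolP.
- by apply/asboolP/asboolP => ->.
- by move=> /asboolP xy /asboolP yz; apply/asboolP; rewrite xy.
Qed.

Canonical same_orbit_equiv_rel := EquivRelPack same_orbit_equiv.

(* S / T^k, for an invariant subset S with the subspace topology. *)
Definition orbit_space : topologicalType :=
  quotient_topology {eq_quot same_orbit}.

Definition orbit_proj (x : set_type S) : orbit_space :=
  \pi_({eq_quot same_orbit}) x.

Definition orbit_repr (q : orbit_space) : set_type S :=
  repr (q : {eq_quot same_orbit}).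

End OrbitSpace.
End Torus.

(* The triple (M, theta, mu) without the conditions on strata. The smooth
   structure of M is [max_atlas tatlas]; closed means compact. *)
Record torus_manifold (R : realType) (n k : nat) := TorusManifold {
  tspace :> topologicalType;
  tatlas : set (chart R tspace (2 * n));
  orient : set (chart R tspace (2 * n));
  theta : 'M[R]_(k, 2) -> tspace -> tspace;
  mu : tspace -> 'rV[R]_k;
  tatlasP : smooth_manifold tatlas;
  tcompact : compact [set: tspace];
  orientP : orientation tatlas orient;
  theta_smooth : smooth_torus_action tatlas theta;
  theta_effective : forall t, torus t -> (forall x, theta t x = x) ->
    t = torus1 R k;
  theta_stab : forall x, connected (stabilizer theta x);
  mu_smooth : smooth_open tatlas (eucl_atlas R k) setT mu;
  mu_inv : forall t x, torus t -> mu (theta t x) = mu x;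
  mu_polytope : polytope (range mu);
  mu_dim : aff_dim (range mu) k;
  mu_open : forall U : set tspace, open U ->
    exists2 V : set 'rV[R]_k, open V & mu @` U = V `&` range mu
}.
Arguments tatlas {R n k} _.
Arguments orient {R n k} _.
Arguments theta {R n k} _.
Arguments mu {R n k} _.

Section Strata.
Variables (R : realType) (n k m : nat) (X : torus_manifold R n k).
Variables (M_ : 'I_m -> set X) (x_ : 'I_m -> X).

Definition stratum (s : {set 'I_m}) : set X :=
  [set y | forall i, (i \in s) <-> M_ i y].

Definition hull_of (s : {set 'I_m}) : set 'rV[R]_k :=
  conv_hull [set mu X (x_ i) | i in [set i | i \in s]].

End Strata.

(* The open sets M_i are the domains of the charts [chart_ i]. *)
Record stratified_manifold (R : realType) (n k : nat) := StratifiedManifold {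
  sbase :> torus_manifold R n k;
  nfix : nat;
  chart_ : 'I_nfix -> chart R sbase (2 * n);
  fixpt : 'I_nfix -> sbase;
  chart_smooth : forall i, max_atlas (tatlas sbase) (chart_ i);
  chart_onto : forall i, cimg (chart_ i) = setT;
  chart_cover : \bigcup_i cdom (chart_ i) = setT;
  chart_inv : forall i, invariant_set (theta sbase) (cdom (chart_ i));
  chart_dense : forall i, dense (cdom (chart_ i));
  chart_fixpt : forall i,
    cdom (chart_ i) `&` fixed_points (theta sbase) = [set fixpt i];
  chart_fixpt0 : forall i, cmap (chart_ i) (fixpt i) = 0;
  fixpt_inj : injective fixpt;
  fixpt_vertices : set_bij (fixed_points (theta sbase))
    (vertices (range (mu sbase))) (mu sbase);
  stratum_stab : forall s y z,
    stratum (fun i => cdom (chart_ i)) s y ->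
    stratum (fun i => cdom (chart_ i)) s z ->
    stabilizer (theta sbase) y = stabilizer (theta sbase) z;
  stratum_mu : forall s, stratum (fun i => cdom (chart_ i)) s !=set0 ->
    mu sbase @` stratum (fun i => cdom (chart_ i)) s =
    relint (hull_of fixpt s);
  stratum_dim : forall s y, stratum (fun i => cdom (chart_ i)) s y ->
    exists2 d, aff_dim (hull_of fixpt s) d
             & torus_quotient_dim (stabilizer (theta sbase) y) d
}.
Arguments chart_ {R n k _}.
Arguments fixpt {R n k _}.

Section AdmissibleSets.
Variables (R : realType) (n k : nat) (X : stratified_manifold R n k).

Definition Wset (s : {set 'I_(nfix X)}) : set X :=
  stratum (fun i => cdom (chart_ i)) s.

Definition adm : choiceType :=
  set_type [set s : {set 'I_(nfix X)} | Wset s !=set0].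

Definition W (s : adm) : set X := Wset (set_val s).

Definition Pol (s : adm) : set 'rV[R]_k := hull_of (@fixpt _ _ _ X) (set_val s).

(* W_s / T^s: the orbits of T^s, the quotient of T^k by the stabilizer of the
   points of W_s, are the orbits of T^k. *)
Definition orbits (s : adm) : topologicalType := orbit_space (theta X) (W s).

Lemma mu_in (s : adm) (y : X) : W s y -> mu X y \in relint (Pol s).
Proof.
move=> Wy; rewrite inE /Pol -stratum_mu; last by exists y.
by exists y.
Qed.

(* The map W_s / T^k -> ri P_s induced by mu. *)
Definition mu_hat (s : adm) (q : orbits s) : set_type (relint (Pol s)) :=
  exist _ (mu X (set_val (orbit_repr q))) (mu_in (set_valP (orbit_repr q))).

Definition support (y : X) : {set 'I_(nfix X)} :=
  [set i | `[< cdom (chart_ i) y >]]%SET.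

Lemma support_W (y : X) : Wset (support y) y.
Proof. by move=> i; rewrite inE; split => /asboolP. Qed.

Lemma support_adm (y : X) :
  support y \in [set s : {set 'I_(nfix X)} | Wset s !=set0].
Proof. by rewrite inE; exists y; exact: support_W. Qed.

Definition stratum_of (y : X) : adm := exist _ (support y) (support_adm y).

End AdmissibleSets.

Section Leaves.
Variables (R : realType) (n k : nat) (X : stratified_manifold R n k).
Variables (F_ : adm X -> topologicalType).
Variable h : forall s, orbits s -> (set_type (relint (Pol s)) * F_ s)%type.

(* [param_of] is xi_s composed with the projection W_s -> W_s / T^k. *)
Definition param_of (s : adm X) (y : set_type (W s)) : F_ s :=
  (h (orbit_proj (theta X) y)).2.

Definition leaf_of (s : adm X) (c : F_ s) : set X :=
  [set set_val y | y in [set y | param_of y = c]].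

End Leaves.

(* F_ s is the space of parameters of W_s and [h s] the chosen trivialization
   of W_s / T^k -> ri P_s. [bface s t] says that leaves of W_t occur in the
   boundaries of the leaves of W_s; [eta s t] is relevant only for such t. *)
Record leaf_manifold (R : realType) (n k : nat) := LeafManifold {
  lbase :> stratified_manifold R n k;
  F_ : adm lbase -> topologicalType;
  h : forall s, orbits s -> (set_type (relint (Pol s)) * F_ s)%type;
  bface : adm lbase -> adm lbase -> Prop;
  eta : forall s t, F_ s -> F_ t;
  stratum_bundle : forall s, fiber_bundle (F_ s) (@mu_hat _ _ _ lbase s);
  h_homeo : forall s, homeomorphism (@h s);
  h_mu : forall s q, (@h s q).1 = mu_hat q;
  leaf_submanifold : forall s (c : F_ s),
    smooth_submanifold (tatlas lbase) (leaf_of h c);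
  leaf_bundle : forall s (c : F_ s),
    smooth_fiber_bundle (tatlas lbase) (leaf_of h c) (relint (Pol s)) (mu lbase);
  bface_face : forall s t, bface s t -> face_of (Pol t) (Pol s);
  leaf_boundary : forall s (c : F_ s),
    closure (leaf_of h c) `\` leaf_of h c =
    \bigcup_(t in [set t | bface s t]) leaf_of h (@eta s t c);
  eta_continuous : forall s t, bface s t -> continuous (@eta s t)
}.
Arguments F_ {R n k _}.
Arguments h {R n k _}.
Arguments bface {R n k _}.
Arguments eta {R n k _}.

Section Complexes.
Variables (R : realType) (n k : nat) (X : leaf_manifold R n k).

Definition param (s : adm X) : set_type (W s) -> F_ s := @param_of _ _ _ X F_ h s.

(* C(M, P), the disjoint union of the relative interiors of the P_s. *)
Definition complexC : choiceType := {s : adm X & set_type (relint (Pol s))}.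

Definition pi_hat (x : complexC) : 'rV[R]_k := set_val (tagged x).

Definition toC (y : X) : complexC :=
  existT _ (stratum_of y)
    (exist _ (mu X y) (@mu_in _ _ _ X (stratum_of y) y (support_W y))).

(* [complexC] carries the topology of a disjoint union, [CQ] the quotient
   topology of [toC]. *)
Definition CQ : topologicalType := final_topology toC.

Definition Eset : set (CQ * X)%type :=
  [set p : CQ * X | W (tag (p.1 : complexC)) p.2 /\ pi_hat p.1 = mu X p.2].

(* The space E(M, P), with the subspace topology of CQ x M. *)
Definition Espace : topologicalType := set_type Eset.

Definition G2 (p : Espace) : X := (set_val p).2.

Definition E_act (t : 'M[R]_(k, 2)) (p : CQ * X) : CQ * X :=
  (p.1, theta X t p.2).

Definition E_orbits : topologicalType := orbit_space E_act Eset.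

Lemma EsetW (p : Espace) :
  (set_val p).2 \in W (tag ((set_val p).1 : complexC)).
Proof. by rewrite inE; case: (set_valP p). Qed.

(* The coordinates (x, c) of a point of E(M, P) / T^k. *)
Definition E_coord (q : E_orbits) : {x : complexC & F_ (tag x)} :=
  let p : Espace := orbit_repr q in
  existT _ ((set_val p).1 : complexC)
    (param (exist _ (set_val p).2 (EsetW p))).

Section Total.
Variables (Ft : adm X -> topologicalType) (calF : topologicalType).
Variable I_ : forall s, Ft s -> calF.

Definition total_embed (e : {x : complexC & Ft (tag x)}) : (CQ * calF)%type :=
  (tag e : CQ, I_ (tagged e)).

(* The space \bigcup_s P'_s x Ft_s, with the topology induced by CQ x calF. *)
Definition total_space : topologicalType := initial_topology total_embed.

End Total.
End Complexes.

Record manifold2nk (R : realType) (n k : nat) := Manifold2nk {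
  mbase :> leaf_manifold R n k;
  calF : topologicalType;
  Ft : adm mbase -> topologicalType;
  I_ : forall s, Ft s -> calF;
  p_ : forall s, Ft s -> F_ s;
  I_continuous : forall s, continuous (@I_ s);
  I_inj : forall s, injective (@I_ s);
  (* The hypothesis on s singles out the main stratum. *)
  Ft_main : forall s, set_val s = [set: 'I_(nfix mbase)]%SET -> Ft s = F_ s;
  calF_compact : compact [set: calF];
  calF_dense : forall s, set_val s = [set: 'I_(nfix mbase)]%SET ->
    dense (range (@I_ s));
  I_face : forall s t, face_of (Pol t) (Pol s) -> range (@I_ s) `<=` range (@I_ t);
  I_cover : \bigcup_(s in [set s | exists i, set_val s = [set i]%SET])
    range (@I_ s) = setT;
  (* I_ d = I_ c says that d is the image of c under the inclusion of Ft s in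
     Ft t. *)
  p_continuous : forall s, continuous (@p_ s);
  p_surj : forall s, range (@p_ s) = setT;
  p_eta : forall s t, bface s t -> forall (c : Ft s) (d : Ft t),
    I_ d = I_ c -> p_ d = eta s t (p_ c);
  H_continuous : exists2 H : total_space I_ -> E_orbits mbase,
    (forall e : {x : complexC mbase & Ft (tag x)},
      E_coord (H e) = existT _ (tag e) (p_ (tagged e)))
    & continuous H
}.

(* Main.v *)
Require Import Defs.
From mathcomp Require Import all_boot all_order all_algebra.
From mathcomp Require Import all_classical all_reals all_analysis.

(** The space E(M, P) is the graph of the map [toC] from M to CQ(M, P), with
    the two factors exchanged: since the strata partition M, a pair (x, y) with
    y in W_s, x in the cell over the interior of P_s and x lying over mu(y)
    leaves x no freedom ([EsetE]).  The topology of CQ(M, P) is the quotient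
    topology of [toC], so [toC] is continuous ([final_continuous]), and the
    graph of a continuous map is homeomorphic to its source through the
    projection, with inverse y |-> (toC(y), y). *)

(** Openness in the final topology is by definition openness of the
    preimage. *)
Lemma final_continuous (X : topologicalType) (Y : choiceType) (f : X -> Y) :
  continuous (f : X -> final_topology f).
Proof. by apply/continuousP. Qed.

Section GraphOfToC.
Variables (R : realType) (n k : nat) (X : leaf_manifold R n k).

Lemma stratum_of_uniq (s : adm X) (y : X) : W s y -> s = stratum_of y.
Proof.
move=> Wy; apply: val_inj; apply/setP => i /=.
by rewrite inE; apply/idP/asboolP => /(Wy i).
Qed.

(** The point y fixes the index of the cell, because the strata are disjoint,
    and mu(y) fixes the position inside that cell. *)
Lemma EsetE (p : CQ X * X) : Eset p <-> p.1 = toC p.2.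
Proof.
case: p => [x y] /=; split=> [[/= Wy xy]|->]; last first.
  by split=> //=; exact: support_W.
case: x Wy xy => s x /= /stratum_of_uniq es; subst s => xy.
by congr existT; exact: val_inj.
Qed.

Lemma graph_in (y : X) : (toC y : CQ X, y) \in @Eset R n k X.
Proof. by rewrite inE; apply/EsetE. Qed.

Definition graph (y : X) : Espace X := exist _ (toC y : CQ X, y) (graph_in y).

Lemma graph_continuous : continuous graph.
Proof.
apply: continuous_comp_initial => y.
apply: (@cvg_pair _ _ _ _ (nbhs (toC y : CQ X)) (nbhs y)).
  exact: final_continuous.
exact: cvg_id.
Qed.

Lemma G2_continuous : continuous (@G2 R n k X).
Proof.
move=> p; apply: (@continuous_comp _ _ _ set_val snd).
  exact: initial_continuous.
exact: cvg_snd.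
Qed.

Lemma G2K : cancel (@G2 R n k X) graph.
Proof.
move=> p; apply: val_inj.
case: p => [[x y] Exy]; rewrite /G2 /=.
by move: (Exy); rewrite inE => /EsetE /= ->.
Qed.

End GraphOfToC.

Theorem theorem9p3 (R : realType) (n k : nat) (hk : (1 <= k <= n)%N)
    (M : manifold2nk R n k) :
  homeomorphism (@G2 R n k M : Espace M -> M).
Proof.
split; first exact: G2_continuous.
exists (@graph R n k M); split=> //.
- exact: graph_continuous.
- exact: G2K.
Qed.
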